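(* Let $I\subset(0,\infty)$ be an interval, let $f:I\to\mathbb{R}$ be differentiable on $I^{\circ}$, and let $a,b\in I$ with $a<b$, where $f'$ exists at every point of $[a,b]$ (one-sided derivative at $a$ or $b$ if that point is an endpoint of $I$), and $f'\in L[a,b]$. Let $q\ge 1$ and suppose $|f'|^q$ is harmonically convex on $[a,b]$. Then $$\left|f\left(\frac{2ab}{a+b}\right)-\frac{ab}{b-a}\int_a^b\frac{f(x)}{x^2}\,dx\right|\le\frac{ab(b-a)}{2}\Big\{C_1(0;a,b)^{1-\frac1q}\big[C_2(0;a,b)|f'(a)|^q+C_3(0;a,b)|f'(b)|^q\big]^{\frac1q}$$ $$\qquad+C_1(0;b,a)^{1-\frac1q}\big[C_3(0;b,a)|f'(a)|^q+C_2(0;b,a)|f'(b)|^q\big]^{\frac1q}\Big\},$$ where, for $u,\vartheta>0$ with $u\ne\vartheta$, $$C_1(0;u,\vartheta)=\frac{2}{(\vartheta-u)^2}\left[\ln\left(\frac{u+\vartheta}{2u}\right)-\frac{\vartheta-u}{u+\vartheta}\right],$$ $$C_2(0;u,\vartheta)=\frac{1}{(\vartheta-u)^3}\left[\frac{(3u+\vartheta)(\vartheta-u)}{u+\vartheta}+4u\ln\left(\frac{2u}{u+\vartheta}\right)\right],$$ $$C_3(0;u,\vartheta)=\frac{1}{(\vartheta-u)^2}\left[\frac{2(u+\vartheta)}{\vartheta-u}\ln\left(\frac{u+\vartheta}{2u}\right)-\frac{u+3\vartheta}{u+\vartheta}\right].$$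
   Context: A function $g:J\to\mathbb{R}$ on an interval $J\subset\mathbb{R}\setminus\{0\}$ is harmonically convex if $g\left(\frac{xy}{tx+(1-t)y}\right)\le t\,g(y)+(1-t)\,g(x)$ for all $x,y\in J$ and $t\in[0,1]$. $L[a,b]$ denotes the Lebesgue integrable functions on $[a,b]$. *)

(* Defs.v *)
From HB Require Import structures.
From mathcomp Require Import all_boot all_order all_algebra.
From mathcomp Require Import all_classical all_reals all_analysis.

Set Implicit Arguments.
Unset Strict Implicit.
Unset Printing Implicit Defensive.

Import Order.TTheory GRing.Theory Num.Theory.
Import numFieldNormedType.Exports.

Local Open Scope classical_set_scope.
Local Open Scope ring_scope.

(* Derivative of f relative to A: the increments h are restricted to those with
   h + x in A.  It is the usual derivative when x is interior to A, and the
   one-sided derivative when A is an interval having x as an endpoint.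
   Functions on A are represented by total functions, and the values of f
   outside A play no role when x is in A. *)
Definition diffquo_within (R : realType) (A : set R) (f : R -> R) (x : R) :=
  h^-1 * (f (h + x) - f x) @[h --> within [set h : R | A (h + x)] 0^'].

Definition derivable_within (R : realType) (A : set R) (f : R -> R) (x : R) :
  Prop := cvg (diffquo_within A f x).

Definition derive_within (R : realType) (A : set R) (f : R -> R) (x : R) : R :=
  lim (diffquo_within A f x).

Lemma diffquo_within_interior (R : realType) (A : set R) (f : R -> R) (x : R) :
  interior A x ->
  diffquo_within A f x = (h^-1 *: (f (h + x) - f x) @[h --> (0 : R)^']).
Proof.
move=> Ax; rewrite /diffquo_within.
suff -> : within [set h : R | A (h + x)] 0^' = (0 : R)^' by [].
have An : \forall h \near (0 : R)^', A (h + x).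
  have : \forall h \near (0 : R), A (h + x).
    have cx : (fun h : R => h + x) @ (0 : R) --> x.
      rewrite -[X in _ --> X]add0r.
      by apply: cvgD; [exact: cvg_id|exact: cvg_cst].
    exact: cx.
  by rewrite /dnbhs /within/=; apply: filterS.
apply/seteqP; split => B /=; last exact: cvg_within.
by move=> WB; apply: filterS2 An WB => h Ah; apply.
Qed.

Lemma derive_within_interior (R : realType) (A : set R) (f : R -> R) (x : R) :
  interior A x -> derive_within A f x = derive1 f x.
Proof.
by move=> Ax; rewrite /derive_within diffquo_within_interior// /derive1 unlock.
Qed.

(* Meant for J an interval that does not contain 0. *)
Definition harmonically_convex (R : realType) (J : interval R) (g : R -> R) :
  Prop :=
  forall x y t : R, x \in J -> y \in J -> 0 <= t <= 1 ->
    g (x * y / (t * x + (1 - t) * y)) <= t * g y + (1 - t) * g x.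

(* C1, C2, C3 are the constants C_i(lambda; u, v) at lambda = 0, for u, v > 0
   and u != v. *)
Definition C1 (R : realType) (u v : R) : R :=
  2 / (v - u) ^+ 2 * (ln ((u + v) / (2 * u)) - (v - u) / (u + v)).

Definition C2 (R : realType) (u v : R) : R :=
  1 / (v - u) ^+ 3 *
    ((3 * u + v) * (v - u) / (u + v) + 4 * u * ln (2 * u / (u + v))).

Definition C3 (R : realType) (u v : R) : R :=
  1 / (v - u) ^+ 2 *
    (2 * (u + v) / (v - u) * ln ((u + v) / (2 * u)) - (u + 3 * v) / (u + v)).

(* Main.v *)
(* Write [c = 2ab/(a+b)] for the harmonic mean; [1/x^2] has the same integral over
   [a, c] and [c, b], so each half of the interval is estimated separately and no
   integral of [f'] is needed. For any [e > 0], AM-GM and the harmonic convexity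
   of [|f'|^q] bound [|f'(x)|] by some [p + r/x]. Hence [|f x - f c|] is at most
   the increment of [G x = p x + r ln x], and integrating this against [dx/x^2]
   gives a closed form, linear in [(p, r)], whose values are the constants
   [C1, C2, C3] up to the factor [(b-a)^2/2]. Optimising over [e] gives the
   power-mean form of the bound. *)
Require Import Defs.
From HB Require Import structures.
From mathcomp Require Import all_boot all_order all_algebra.
From mathcomp Require Import all_classical all_reals all_analysis.
From mathcomp Require Import ring lra.

Set Implicit Arguments.
Unset Strict Implicit.
Unset Printing Implicit Defensive.

Import Order.TTheory GRing.Theory Num.Theory.
Import numFieldNormedType.Exports.

Local Open Scope classical_set_scope.
Local Open Scope ring_scope.

(** * Young's inequality, optimisation over its parameter, positivity of [C1] *)

Lemma weighted_AMGM (R : realType) (y z q : R) : 0 <= y -> 0 <= z -> 1 <= q ->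
  y * z `^ (q - 1) <= y `^ q / q + (1 - 1 / q) * z `^ q.
Proof.
move=> y0 z0; rewrite le_eqVlt => /predU1P[<-|q1].
  by rewrite subrr powRr0 powRr1// !divr1 subrr mul0r addr0 mulr1.
have q0 : 0 < q by lra.
have := @conjugate_powR _ y (z `^ (q - 1)) q (q / (q - 1)) y0 (powR_ge0 _ _) q0.
rewrite -powRrM mulrCA divff ?mulr1; last by rewrite gt_eqF// subr_gt0.
have -> : q^-1 + (q / (q - 1))^-1 = 1.
  by field; rewrite !gt_eqF// subr_gt0.
have -> : z `^ q / (q / (q - 1)) = (1 - 1 / q) * z `^ q.
  by field; rewrite !gt_eqF// subr_gt0.
by apply=> //; rewrite divr_gt0// subr_gt0.
Qed.

(* The right-hand side of the hypothesis is minimal at [e = (Y / C) `^ (1 / q)];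
   if [Y = 0], let [e] tend to [0]. *)
Lemma le_powR_AMGM (R : realType) (X C Y q : R) : 0 < C -> 0 <= Y -> 1 <= q ->
  (forall e, 0 < e -> X <= e * (1 - 1 / q) * C + e `^ (1 - q) / q * Y) ->
  X <= C `^ (1 - 1 / q) * Y `^ (1 / q).
Proof.
move=> C0; rewrite le_eqVlt => /predU1P[<-|Y0] q1 XE.
  rewrite powR0 ?mulr0; last by rewrite gt_eqF// divr_gt0//; lra.
  have D0 : 0 <= (1 - 1 / q) * C.
    by rewrite mulr_ge0 ?(ltW C0)// subr_ge0 ler_pdivrMr; lra.
  apply/ler_addgt0Pr => e e0; rewrite add0r.
  set D := (1 - 1 / q) * C in D0.
  (* With [Y = 0] the bound at [e / (1 + D)] is [e * D / (1 + D)], at most [e]; the summand [1]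
     keeps the denominator positive even when [D = 0]. *)
  have /XE : 0 < e / (1 + D) by rewrite divr_gt0//; lra.
  rewrite mulr0 addr0 -mulrA -/D => /le_trans; apply.
  by rewrite mulrAC ler_pdivrMr ?ler_pM2l//; lra.
have q0 : 0 < q by lra.
have e0 : 0 < (Y / C) `^ (1 / q) by rewrite powR_gt0// divr_gt0.
(* At the minimiser the two terms are the target multiplied by [1 - 1 / q] and by [1 / q], so their
   sum equals it. *)
apply: le_trans (XE _ e0) _; rewrite -powRrM.
have -> : 1 / q * (1 - q) = 1 / q - 1 by field; rewrite gt_eqF.
have YC0 : Y / C != 0 by rewrite gt_eqF// divr_gt0.
rewrite !powRB ?YC0 ?(gt_eqF C0) ?implybT//.
have [C0' Y0'] := (ltW C0, ltW Y0).
rewrite !powRr1 ?divr_ge0// powRM ?invr_ge0//.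
have -> : C^-1 `^ (1 / q) = (C `^ (1 / q))^-1.
  by rewrite -powR_inv1 ?ltW// powRAC powR_inv1 ?powR_ge0.
have c0 : C `^ (1 / q) != 0 by rewrite gt_eqF// powR_gt0.
rewrite le_eqVlt; apply/orP; left; apply/eqP.
by field; rewrite c0 !gt_eqF.
Qed.

Lemma lt_ln1D (R : realType) (z : R) : 0 < z -> z != 1 -> 1 + ln z < z.
Proof.
move=> z0 z1; rewrite -[X in _ < X]lnK ?posrE//.
by apply: expR_gt1Dx; rewrite ln_eq0.
Qed.

(** With [s = 2 * u / (u + v)], the bracket in [C1] is [s - 1 - ln s], which is positive for
    [s != 1]. Strictness matters because the optimal [e] has [C1] in a denominator. *)
Lemma C1_gt0 (R : realType) (u v : R) : 0 < u -> 0 < v -> u != v -> 0 < C1 u v.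
Proof.
move=> u0 v0 uv; rewrite /C1 mulr_gt0//.
  by rewrite divr_gt0// exprn_even_gt0//= subr_eq0 eq_sym.
have uv0 : 0 < u + v by rewrite addr_gt0.
have -> : (u + v) / (2 * u) = (2 * u / (u + v))^-1 by rewrite invf_div.
rewrite lnV ?posrE ?divr_gt0 ?mulr_gt0//.
have -> : (v - u) / (u + v) = 1 - 2 * u / (u + v).
  by field; rewrite gt_eqF.
have /lt_ln1D : 0 < 2 * u / (u + v) by rewrite divr_gt0// mulr_gt0.
have -> : 2 * u / (u + v) != 1.
  by apply: contra_neq uv => /divr1_eq; lra.
by move=> /(_ isT); lra.
Qed.

(** * Increments of functions and integrals against [1 / x ^+ 2], by comparison with
    [k + p * x + r * ln x] *)

Lemma is_derive1_continuous (R : realType) (f : R -> R) (x d : R) :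
  is_derive x 1 f d -> {for x, continuous f}.
Proof.
by move=> fx; apply/differentiable_continuous/derivable1_diffP.
Qed.

Lemma is_derive1_affine_ln (R : realType) (k p r x : R) : 0 < x ->
  is_derive x 1 (fun y => k + p * y + r * ln y) (p + r / x).
Proof.
move=> x0; have := is_derive1_ln x0 => dln.
by apply: is_derive_eq; rewrite /GRing.scale/= add0r mul1r mulr1.
Qed.

(** Fundamental theorem of calculus; the one antiderivative that is not immediate is
    [- (ln z + 1) / z], for [ln z / z ^+ 2]. *)
Lemma Rintegral_affine_ln (R : realType) (k p r x y : R) : 0 < x -> x < y ->
  \int[lebesgue_measure]_(z in `[x, y]) ((k + p * z + r * ln z) / z ^+ 2) =
  (p * ln y - r * (ln y + 1) / y - k / y) -
  (p * ln x - r * (ln x + 1) / x - k / x).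
Proof.
move=> x0 xy.
pose F z : R := p * ln z - r * (ln z + 1) / z - k / z.
have dF (z : R) : 0 < z -> is_derive z 1 F ((k + p * z + r * ln z) / z ^+ 2).
  move=> z0; have dln := is_derive1_ln z0.
  have z_neq0 : z != 0 by rewrite gt_eqF.
  have dV : is_derive z 1 (fun t : R => t^-1) (- z ^- 2).
    apply: (is_derive_eq (is_deriveV (f := @id R) z_neq0 _)).
    by rewrite /GRing.scale/= mulr1.
  apply: is_derive_eq; rewrite /GRing.scale/=.
  by field.
have cF (z : R) : 0 < z -> {for z, continuous F}.
  by move=> /dF; exact: is_derive1_continuous.
rewrite /Rintegral (@continuous_FTC2 _ _ F)//.
- apply: continuous_in_subspaceT => z; rewrite inE/= in_itv/= => /andP[xz _].
  have z0 : 0 < z by exact: lt_le_trans xz.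
  have cG : {for z, continuous (fun t : R => k + p * t + r * ln t)}.
    exact: is_derive1_continuous (is_derive1_affine_ln k p r z0).
  apply: (cvgM cG); apply: cvgV; first by rewrite expf_neq0// gt_eqF.
  exact: exprn_continuous.
- split.
  + by move=> z /[!in_itv]/= /andP[xz _]; have [] := dF z (lt_trans x0 xz).
  + exact/cvg_at_right_filter/cF.
  + exact/cvg_at_left_filter/cF/(lt_trans x0).
- move=> z /[!in_itv]/= /andP[xz _]; rewrite derive1E.
  by have /@derive_val := dF z (lt_trans x0 xz).
Qed.

(** [G - f] has nonnegative derivative when [G' = p + r / t], hence is nondecreasing. Monotonicity
    takes the place of integrating the derivative of [f]. *)
Lemma le_increment_affine_ln (R : realType) (f : R -> R) (x0 x1 p r : R) :
    0 < x0 -> {within `[x0, x1], continuous f} ->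
    {in `]x0, x1[, forall z, derivable f z 1} ->
    {in `]x0, x1[, forall z, derive1 f z <= p + r / z} ->
  {in `[x0, x1] &, forall z y, z <= y ->
    f y - f z <= p * (y - z) + r * (ln y - ln z)}.
Proof.
move=> x0_gt0 cf df f'le z y zx yx zy.
have pos (t : R) : x0 <= t -> 0 < t by exact: lt_le_trans.
pose G (t : R) := 0 + p * t + r * ln t.
have dG (t : R) : 0 < t -> is_derive t 1 G (p + r / t).
  exact: is_derive1_affine_ln.
have dGf (t : R) : t \in `]x0, x1[ -> is_derive t 1 (G - f) (p + r / t - derive1 f t).
  move=> tx; have t0 : 0 < t by move: tx; rewrite in_itv/= => /andP[/ltW/pos].
  have dft : is_derive t 1 f (derive1 f t).
    by rewrite derive1E; apply/derivableP/df.
  have dGt := dG _ t0.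
  exact: is_deriveB.
suff : (G - f) z <= (G - f) y by rewrite /G !fctE; lra.
apply: (@ger0_derive1_le_cc _ (G - f) x0 x1) => //.
- by move=> t /dGf[].
- move=> t tx; rewrite derive1E (@derive_val _ _ _ _ _ _ _ (dGf t tx)).
  by rewrite subr_ge0 f'le.
- move=> t; apply: cvgB; last exact: cf.
  have : {within `[x0, x1], continuous G}; last exact.
  apply: continuous_in_subspaceT => u; rewrite inE/= in_itv/= => /andP[xu _].
  exact: is_derive1_continuous (dG u (pos u xu)).
Qed.

Lemma le_norm_increment_affine_ln (R : realType) (f : R -> R) (x0 x1 p r : R) :
    0 < x0 -> {within `[x0, x1], continuous f} ->
    {in `]x0, x1[, forall z, derivable f z 1} ->
    {in `]x0, x1[, forall z, `|derive1 f z| <= p + r / z} ->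
  {in `[x0, x1] &, forall z y, z <= y ->
    `|f y - f z| <= p * (y - z) + r * (ln y - ln z)}.
Proof.
move=> x0_gt0 cf df f'le z y zx yx zy; rewrite ler_norml; apply/andP; split.
  rewrite lerNl opprB.
  have -> : f z - f y = (- f) y - (- f) z by rewrite !fctE opprK addrC.
  apply: (le_increment_affine_ln (f := - f)) zx yx zy => //.
  - by move=> t; apply: cvgN; exact: cf.
  - by move=> t /df; exact: derivableN.
  - move=> t tx; rewrite derive1E deriveN; last exact: df.
    by rewrite -derive1E; have := f'le t tx; rewrite ler_norml => /andP[]; lra.
apply: (le_increment_affine_ln (f := f)) zx yx zy => //.
by move=> t tx; exact: le_trans (ler_norm _) (f'le t tx).
Qed.

(* The integral of [G x - G c] against [dx / x ^+ 2] from [c] to [w], where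
   [G' x = p + r / x]. *)
Definition remainder_bound (R : realType) (p r c w : R) : R :=
  p * (ln (w / c) + c / w - 1) + r * (1 / c - 1 / w - ln (w / c) / w).

Lemma integrable_div_sqr (R : realType) (f : R -> R) (x y : R) : 0 < x ->
    {within `[x, y], continuous f} ->
  (@lebesgue_measure R).-integrable `[x, y] (EFin \o (fun z => f z / z ^+ 2)).
Proof.
move=> x0 cf; apply: continuous_compact_integrable; first exact: segment_compact.
move=> t; apply: cvgM; first exact: cf.
have : {within `[x, y], continuous (fun z : R => (z ^+ 2)^-1)}; last exact.
apply: continuous_in_subspaceT => z; rewrite inE/= in_itv/= => /andP[xz _].
apply: cvgV; first by rewrite expf_neq0// gt_eqF// (lt_le_trans x0).
exact: exprn_continuous.
Qed.

Lemma integrable_affine_ln (R : realType) (k p r x y : R) : 0 < x ->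
  (@lebesgue_measure R).-integrable `[x, y]
    (EFin \o (fun z => (k + p * z + r * ln z) / z ^+ 2)).
Proof.
move=> x0; apply: (integrable_div_sqr (f := fun z => k + p * z + r * ln z)) => //.
apply: continuous_in_subspaceT => z; rewrite inE/= in_itv/= => /andP[xz _].
exact: is_derive1_continuous (is_derive1_affine_ln k p r (lt_le_trans x0 xz)).
Qed.

Lemma le_Rintegral_affine_ln (R : realType) (f : R -> R) (k p r k' p' r' x y : R) :
    0 < x -> x < y -> {within `[x, y], continuous f} ->
    {in `[x, y], forall z, k' + p' * z + r' * ln z <= f z <= k + p * z + r * ln z} ->
  (p' * ln y - r' * (ln y + 1) / y - k' / y) -
  (p' * ln x - r' * (ln x + 1) / x - k' / x) <=
  \int[lebesgue_measure]_(z in `[x, y]) (f z / z ^+ 2) <=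
  (p * ln y - r * (ln y + 1) / y - k / y) -
  (p * ln x - r * (ln x + 1) / x - k / x).
Proof.
move=> x0 xy cf fle; rewrite -!Rintegral_affine_ln//.
apply/andP; split; apply: le_Rintegral => //;
  rewrite ?integrable_affine_ln ?integrable_div_sqr//;
  by move=> z /fle/andP[? ?]; rewrite ler_wpM2r// invr_ge0 sqr_ge0.
Qed.

(** Since [1 / x ^+ 2] has integral [|1 / c - 1 / w|], the left side is the absolute value of the
    integral of [(f c - f x) / x ^+ 2], and [|f x - f c|] is at most [|G x - G c|]. If [w < c], both
    [G x - G c] and the orientation of the integral change sign, so one closed form serves both
    orders. *)
Lemma Rintegral_remainder_bound (R : realType) (f : R -> R) (c w p r : R) :
    0 < c -> 0 < w -> c != w ->
    {within `[Num.min c w, Num.max c w], continuous f} ->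
    {in `]Num.min c w, Num.max c w[, forall z, derivable f z 1} ->
    {in `]Num.min c w, Num.max c w[, forall z, `|derive1 f z| <= p + r / z} ->
  `|f c * `|1 / c - 1 / w| -
    \int[lebesgue_measure]_(z in `[Num.min c w, Num.max c w]) (f z / z ^+ 2)|
  <= remainder_bound p r c w.
Proof.
(* Transfers an inequality to another with the same difference of sides, which leaves only a field
   identity to check. *)
have le_eq_sub (x y x' y' : R) : x <= y -> y - x = y' - x' -> x' <= y'.
  by rewrite -subr_ge0 -[x' <= _]subr_ge0 => + <-.
move=> c0 w0; rewrite neq_lt => /orP[] cw.
- rewrite (min_idPl (ltW cw)) (max_idPr (ltW cw)) => cf df f'le.
  have V : 1 / w < 1 / c by rewrite !div1r ltf_pV2.
  rewrite (@ger0_norm _ (1 / c - 1 / w)) ?subr_ge0 ?(ltW V)//.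
  have fle := le_norm_increment_affine_ln c0 cf df f'le.
  have H : {in `[c, w], forall z : R,
      f c + (p * c + r * ln c) + - p * z + - r * ln z <= f z <=
      f c - (p * c + r * ln c) + p * z + r * ln z}.
    move=> z zcw; have := zcw; rewrite in_itv/= => /andP[cz _].
    have /fle/(_ zcw cz) : c \in `[c, w] by rewrite in_itv/= lexx ltW.
    by rewrite ler_norml => /andP[]; lra.
  have /andP[] := le_Rintegral_affine_ln c0 cw cf H.
  rewrite ler_norml /remainder_bound ln_div ?posrE//.
  set J := \int[_]_(_ in _) _ => J1 J2.
  by apply/andP; split; [apply: (le_eq_sub _ _ _ _ J2) | apply: (le_eq_sub _ _ _ _ J1)];
    field; rewrite !gt_eqF.
- rewrite (min_idPr (ltW cw)) (max_idPl (ltW cw)) => cf df f'le.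
  have V : 1 / c < 1 / w by rewrite !div1r ltf_pV2.
  rewrite (@ltr0_norm _ (1 / c - 1 / w)) ?subr_lt0//.
  have fle := le_norm_increment_affine_ln w0 cf df f'le.
  (* Here [z] lies to the left of [c], so the increment is [G c - G z] and the signs of [p] and [r]
     are exchanged between the lower and the upper bound. *)
  have H : {in `[w, c], forall z : R,
      f c - (p * c + r * ln c) + p * z + r * ln z <= f z <=
      f c + (p * c + r * ln c) + - p * z + - r * ln z}.
    move=> z zcw; have := zcw; rewrite in_itv/= => /andP[_ cz].
    have /(fle z c zcw)/(_ cz) : c \in `[w, c] by rewrite in_itv/= lexx ltW.
    by rewrite ler_norml => /andP[]; lra.
  have /andP[] := le_Rintegral_affine_ln w0 cw cf H.
  rewrite ler_norml /remainder_bound ln_div ?posrE//.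
  set J := \int[_]_(_ in _) _ => J1 J2.
  by apply/andP; split; [apply: (le_eq_sub _ _ _ _ J2) | apply: (le_eq_sub _ _ _ _ J1)];
    field; rewrite !gt_eqF.
Qed.

(** * Continuity from differentiability relative to a set *)

(** The increment of [f] is [h] times the difference quotient, a product tending to [0 * l]. The
    quotient says nothing at [h = 0], so the point [y = x] is treated apart. *)
Lemma derivable_within_cvg (R : realType) (A : set R) (f : R -> R) (x : R) :
  derivable_within A f x -> f y @[y --> within A (nbhs x)] --> f x.
Proof.
rewrite /derivable_within /diffquo_within => /cvg_ex[l /= fl].
set W := within _ _ in fl.
have FW : Filter W by exact: within_filter.
have idW : id h @[h --> W] --> (0 : R).
  apply: (cvg_trans (cvg_within _)); exact: (cvg_within (F := nbhs (0 : R))).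
have /= := cvgM idW fl; rewrite mul0r => fW U fxU.
have H : \forall h \near (0 : R), h != 0 -> A (h + x) -> U (f (h + x)).
  have /(_ _ (f x) 0 (cvg_cst (f x)) (fW FW)) := @cvgD R R R W FW (fun=> f x).
  rewrite addr0 => /(_ U fxU) fWU.
  have {}fWU : \forall h \near (0 : R), h != 0 -> A (h + x) ->
      U (f x + h * (h^-1 * (f (h + x) - f x))) by exact: fWU.
  apply: filterS fWU => h fWh h0 Ah; have := fWh h0 Ah.
  by rewrite mulrA mulfV// mul1r subrKC.
have cx : (fun y : R => y - x) @ x --> (0 : R).
  have := @cvgB R R R (nbhs x) _ id (fun=> x) x x cvg_id (cvg_cst x).
  by rewrite subrr; exact.
have {}H : \forall y \near x, y - x != 0 -> A (y - x + x) -> U (f (y - x + x)).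
  exact: cx _ H.
suff : \forall y \near x, A y -> U (f y) by [].
apply: filterS H => y; rewrite subrK subr_eq0 => Hy Ay.
have [->|yx] := eqVneq y x; first exact: nbhs_singleton.
exact: Hy.
Qed.

Lemma derivable_within_itv_continuous (R : realType) (I : interval R)
    (f : R -> R) (a b : R) : a < b -> a \in I -> b \in I ->
    {in `[a, b], forall x, derivable_within [set` I] f x} ->
  {within `[a, b], continuous f}.
Proof.
move=> ab aI bI fI.
have abI x : a <= x <= b -> x \in I.
  move=> axb; apply: (interval_is_interval aI bI); exact: axb.
have abI' : `[a, b] `<=` [set` I] by move=> x /=; rewrite in_itv/= => /abI.
apply/subspace_continuousP => x xab.
move=> U /(derivable_within_cvg (fI x xab)) fU.
have {}fU : \forall y \near x, y \in I -> U (f y) by exact: fU.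
suff : \forall y \near x, `[a, b]%classic y -> U (f y) by [].
by apply: filterS fU => y fU /abI'.
Qed.

(** * The constants as remainder bounds, and the estimate on one half of the interval *)

(** The integral estimate for the zero function bounds a norm by this quantity, so no inequality on
    logarithms is required. *)
Lemma remainder_bound_ge0 (R : realType) (c w p r : R) :
    0 < c -> 0 < w -> c != w ->
    {in `]Num.min c w, Num.max c w[, forall z, 0 <= p + r / z} ->
  0 <= remainder_bound p r c w.
Proof.
move=> c0 w0 cw pr.
apply: le_trans (@Rintegral_remainder_bound _ (cst 0) c w p r c0 w0 cw _ _ _) => //.
- by move=> z; exact: cvg_cst.
- by move=> z /pr; rewrite derive1_cst normr0.
Qed.

Section half_interval.
Variables (R : realType) (u v : R).
Hypotheses (u0 : 0 < u) (v0 : 0 < v) (uv : u != v).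
(** The harmonic mean, symmetric in [u] and [v], whose order is left open: [(a, b)] gives the half
    [[c, b]] and [(b, a)] gives [[a, c]]. *)
Let c := 2 * u * v / (u + v).

Let vu0 : v - u != 0. Proof. by rewrite subr_eq0 eq_sym. Qed.

Let c0 : 0 < c.
Proof. by rewrite divr_gt0 ?mulr_gt0 ?addr_gt0. Qed.

Let cv : c != v.
Proof.
rewrite -subr_eq0 (_ : c - v = v * (u - v) / (u + v)); last first.
  by rewrite /c; field; rewrite gt_eqF// addr_gt0.
by rewrite !mulf_neq0 ?invr_eq0 ?subr_eq0// gt_eqF// addr_gt0.
Qed.

Let lnvc : ln (v / c) = ln ((u + v) / (2 * u)).
Proof. by congr ln; rewrite /c; field; rewrite !gt_eqF// addr_gt0. Qed.

Let lnVvc : ln (2 * u / (u + v)) = - ln ((u + v) / (2 * u)).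
Proof.
by rewrite -lnV ?invf_div// posrE divr_gt0 ?mulr_gt0 ?addr_gt0.
Qed.

Lemma remainder_bound_C1 :
  remainder_bound 1 0 c v = (v - u) ^+ 2 / 2 * C1 u v.
Proof.
rewrite /remainder_bound /C1 lnvc /c; field.
by rewrite vu0 !gt_eqF// addr_gt0.
Qed.

(** Here [p + r / x] is [u * (v - x) / ((v - u) * x)], the weight of the endpoint [u] in harmonic
    convexity: affine in [1 / x], equal to [1] at [u] and [0] at [v]. *)
Lemma remainder_bound_C2 :
  remainder_bound (- u / (v - u)) (u * v / (v - u)) c v =
  (v - u) ^+ 2 / 2 * C2 u v.
Proof.
rewrite /remainder_bound /C2 lnvc lnVvc /c; field.
by rewrite vu0 !gt_eqF// addr_gt0.
Qed.

(** The complementary weight [v * (x - u) / ((v - u) * x)], attached to the endpoint [v]. *)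
Lemma remainder_bound_C3 :
  remainder_bound (v / (v - u)) (- (u * v) / (v - u)) c v =
  (v - u) ^+ 2 / 2 * C3 u v.
Proof.
rewrite /remainder_bound /C3 lnvc /c; field.
by rewrite vu0 !gt_eqF// addr_gt0.
Qed.

Let between x : x \in `]Num.min c v, Num.max c v[ ->
  0 < x /\ (u < x < v) || (v < x < u).
Proof.
have uv0 : 0 < u + v by rewrite addr_gt0.
have cvE : c - v = v * (u - v) / (u + v) by rewrite /c; field; rewrite gt_eqF.
have cuE : c - u = u * (v - u) / (u + v) by rewrite /c; field; rewrite gt_eqF.
rewrite in_itv/=; move: uv; rewrite neq_lt => /orP[] uv'.
- have cv' : c < v by rewrite -subr_lt0 cvE pmulr_llt0 ?invr_gt0// pmulr_rlt0// subr_lt0.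
  have uc : u < c by rewrite -subr_gt0 cuE divr_gt0// mulr_gt0// subr_gt0.
  rewrite (min_idPl (ltW cv')) (max_idPr (ltW cv')) => /andP[cx xv].
  by rewrite (lt_trans uc cx) xv; split => //; exact: lt_trans cx.
- have cv' : v < c by rewrite -subr_gt0 cvE divr_gt0// mulr_gt0// subr_gt0.
  have uc : c < u by rewrite -subr_lt0 cuE pmulr_llt0 ?invr_gt0// pmulr_rlt0// subr_lt0.
  rewrite (min_idPr (ltW cv')) (max_idPl (ltW cv')) => /andP[cx xv].
  by rewrite cx (lt_trans xv uc) orbT; split => //; exact: lt_trans cx.
Qed.

(** The weight of [u] is nonnegative between [c] and [v], because [v - x] and [v - u] have the same
    sign there. *)
Lemma C2_ge0 : 0 <= C2 u v.
Proof.
have D : 0 < (v - u) ^+ 2 / 2 by rewrite divr_gt0// exprn_even_gt0.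
rewrite -(pmulr_rge0 _ D) -remainder_bound_C2 remainder_bound_ge0// => x.
move=> /between[x0 xuv].
have -> : - u / (v - u) + u * v / (v - u) / x = u * ((v - x) / (v - u)) / x.
  by field; rewrite vu0 gt_eqF.
rewrite divr_ge0 ?(ltW x0)// mulr_ge0 ?(ltW u0)//.
case/orP: xuv => /andP[ux xv]; first by rewrite divr_ge0; lra.
by rewrite -mulrNN -invrN divr_ge0; lra.
Qed.

Lemma C3_ge0 : 0 <= C3 u v.
Proof.
have D : 0 < (v - u) ^+ 2 / 2 by rewrite divr_gt0// exprn_even_gt0.
rewrite -(pmulr_rge0 _ D) -remainder_bound_C3 remainder_bound_ge0// => x.
move=> /between[x0 xuv].
have -> : v / (v - u) + - (u * v) / (v - u) / x = v * ((x - u) / (v - u)) / x.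
  by field; rewrite vu0 gt_eqF.
rewrite divr_ge0 ?(ltW x0)// mulr_ge0 ?(ltW v0)//.
case/orP: xuv => /andP[ux xv]; first by rewrite divr_ge0; lra.
by rewrite -mulrNN -invrN divr_ge0; lra.
Qed.

(** For each [e > 0], Young's inequality turns the bound on the [q]-th power into one of the form
    [p + r / z]; its remainder bound is linear in [C1] and [C2 * A + C3 * B], and optimising over
    [e] gives the product of powers. *)
Lemma half_interval_estimate (f : R -> R) (q A B : R) :
    1 <= q -> 0 <= A -> 0 <= B ->
    {within `[Num.min c v, Num.max c v], continuous f} ->
    {in `]Num.min c v, Num.max c v[, forall z, derivable f z 1} ->
    {in `]Num.min c v, Num.max c v[, forall z, `|derive1 f z| `^ q <=
      (- u / (v - u) + u * v / (v - u) / z) * A +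
      (v / (v - u) + - (u * v) / (v - u) / z) * B} ->
  `|f c * `|1 / c - 1 / v| - \int[lebesgue_measure]_(z in
      `[Num.min c v, Num.max c v]) (f z / z ^+ 2)| <=
  (v - u) ^+ 2 / 2 * (C1 u v `^ (1 - 1 / q) * (C2 u v * A + C3 u v * B) `^ (1 / q)).
Proof.
move=> q1 A0 B0 cf df f'q.
have D : 0 < (v - u) ^+ 2 / 2 by rewrite divr_gt0// exprn_even_gt0.
have q0 : 0 < q by lra.
rewrite [leRHS]mulrC -ler_pdivrMr//.
apply: le_powR_AMGM => //; first exact: C1_gt0.
  by rewrite addr_ge0// mulr_ge0 ?C2_ge0 ?C3_ge0.
move=> e e0; rewrite ler_pdivrMr//.
set k := e `^ (1 - q) / q.
set p := e * (1 - 1 / q) + k * (- u / (v - u) * A + v / (v - u) * B).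
set r := k * (u * v / (v - u) * A + - (u * v) / (v - u) * B).
(* [remainder_bound] is linear in [(p, r)], so the three identities for the constants add up. *)
have -> : (e * (1 - 1 / q) * C1 u v + k * (C2 u v * A + C3 u v * B)) *
    ((v - u) ^+ 2 / 2) = remainder_bound p r c v.
  transitivity (e * (1 - 1 / q) * remainder_bound 1 0 c v + k * (
    A * remainder_bound (- u / (v - u)) (u * v / (v - u)) c v +
    B * remainder_bound (v / (v - u)) (- (u * v) / (v - u)) c v)).
    by rewrite remainder_bound_C1 remainder_bound_C2 remainder_bound_C3; ring.
  by rewrite /remainder_bound /p /r; ring.
apply: Rintegral_remainder_bound => // z zcv.
have e1 : 0 < e `^ (1 - q) by exact: powR_gt0.
have := weighted_AMGM (normr_ge0 (derive1 f z)) (ltW e0) q1.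
rewrite -(ler_pM2r e1) -mulrA -powRD ?(gt_eqF e0) ?implybT//.
rewrite (_ : q - 1 + (1 - q) = 0) ?powRr0 ?mulr1; last by ring.
rewrite mulrDl -[X in _ + X]mulrA -powRD ?(gt_eqF e0) ?implybT//.
rewrite (_ : q + (1 - q) = 1) ?powRr1 ?(ltW e0)//; last by ring.
rewrite mulrAC -mulrA -/k => /le_trans; apply.
have k0 : 0 <= k by rewrite divr_ge0 ?ltW.
apply: le_trans (lerD (ler_wpM2r k0 (f'q _ zcv)) (lexx _)) _.
rewrite le_eqVlt; apply/orP; left; apply/eqP.
by rewrite /p /r; ring.
Qed.

End half_interval.

(** * Harmonic convexity at an interior point, and the combination of the two halves *)

Theorem corollary1 (R : realType) (I : interval R) (f : R -> R) (a b q : R)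
    (I_pos : forall x, x \in I -> 0 < x)
    (f_diff : forall x, interior [set` I] x -> derivable f x 1)
    (aI : a \in I) (bI : b \in I) (ab : a < b)
    (f'_ex : forall x, x \in `[a, b] -> derivable_within [set` I] f x)
    (f'_int : (@lebesgue_measure R).-integrable `[a, b]
                (EFin \o derive_within [set` I] f))
    (q1 : 1 <= q)
    (f'_hconv : harmonically_convex `[a, b]
                  (fun x => `|derive_within [set` I] f x| `^ q)) :
  let f' := derive_within [set` I] f in
  `| f (2 * a * b / (a + b))
     - a * b / (b - a) *
         (\int[@lebesgue_measure R]_(x in `[a, b]) (f x / x ^+ 2)) |
  <= a * b * (b - a) / 2 *
     (C1 a b `^ (1 - 1 / q) *
        (C2 a b * `|f' a| `^ q + C3 a b * `|f' b| `^ q) `^ (1 / q)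
      + C1 b a `^ (1 - 1 / q) *
        (C3 b a * `|f' a| `^ q + C2 b a * `|f' b| `^ q) `^ (1 / q)).
Proof.
cbv zeta; set f' := derive_within [set` I] f.
have [a0 b0] := (I_pos _ aI, I_pos _ bI).
have ab_neq : a != b by rewrite lt_eqF.
have ba_neq : b != a by rewrite eq_sym.
set c := 2 * a * b / (a + b).
have abI x : a <= x <= b -> x \in I by exact: interval_is_interval aI bI _.
have int_ab : {in `]a, b[, forall x, interior [set` I] x}.
  move=> x /[!in_itv]/= /andP[ax xb].
  have : \forall y \near x, a < y < b by apply: near_in_itvoo; rewrite in_itv/= ax.
  by apply: filterS => y /= /andP[ay yb]; rewrite abI// !ltW.
(* On the open interval the relative derivative is the ordinary one, so harmonic convexity controls
   [derive1 f]; only the values at [a] and [b] may be one-sided. *)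
have f'E : {in `]a, b[, f' =1 derive1 f}.
  by move=> x /int_ab; exact: derive_within_interior.
have cf : {within `[a, b], continuous f}.
  exact: derivable_within_itv_continuous aI bI f'_ex.
have f'q x : a < x < b -> `|derive1 f x| `^ q <=
    (- a / (b - a) + a * b / (b - a) / x) * `|f' a| `^ q +
    (b / (b - a) + - (a * b) / (b - a) / x) * `|f' b| `^ q.
  move=> /andP[ax xb]; have x0 := lt_trans a0 ax.
  have ba0 : b - a != 0 by rewrite subr_eq0.
  (* The solution of [a * b / (t * a + (1 - t) * b) = x]. *)
  set t := b / (b - a) + - (a * b) / (b - a) / x.
  have tE : t = b * ((x - a) / (b - a)) / x.
    by rewrite /t; field; rewrite ba0 gt_eqF.
  have t1E : 1 - t = a * ((b - x) / (b - a)) / x.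
    by rewrite /t; field; rewrite ba0 gt_eqF.
  have t01 : 0 <= t <= 1.
    apply/andP; split; [rewrite tE | rewrite -subr_ge0 t1E];
      by rewrite divr_ge0 ?(ltW x0)// mulr_ge0 ?(ltW a0) ?(ltW b0)// divr_ge0; lra.
  have := f'_hconv a b t _ _ t01; rewrite !in_itv/= !lexx (ltW ab).
  move=> /(_ isT isT).
  have -> : a * b / (t * a + (1 - t) * b) = x.
    have -> : t * a + (1 - t) * b = a * b / x.
      by rewrite /t; field; rewrite ba0 gt_eqF.
    by field; rewrite !gt_eqF.
  have <- : f' x = derive1 f x by apply: f'E; rewrite in_itv/= ax.
  have -> : 1 - t = - a / (b - a) + a * b / (b - a) / x.
    by rewrite /t; field; rewrite ba0 gt_eqF.
  by rewrite [in X in X -> _]addrC; exact.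
have abD : 0 < a + b by rewrite addr_gt0.
have ac : a < c.
  rewrite -subr_gt0 (_ : c - a = a * (b - a) / (a + b)).
    by rewrite divr_gt0// mulr_gt0// subr_gt0.
  by rewrite /c; field; rewrite gt_eqF.
have cb : c < b.
  rewrite -subr_gt0 (_ : b - c = b * (b - a) / (a + b)).
    by rewrite divr_gt0// mulr_gt0// subr_gt0.
  by rewrite /c; field; rewrite gt_eqF.
have c0 : 0 < c by exact: lt_trans ac.
have sub_ab (x y : R) : a <= x -> y <= b -> {in `]x, y[, forall z, a < z < b}.
  move=> ax yb z /[!in_itv]/= /andP[xz zy].
  by rewrite (le_lt_trans ax xz) (lt_le_trans zy yb).
have cf_sub (x y : R) : a <= x -> y <= b -> {within `[x, y], continuous f}.
  move=> ax yb; apply: continuous_subspaceW cf => z /=.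
  rewrite !in_itv/= => /andP[xz zy].
  by rewrite (le_trans ax xz) (le_trans zy yb).
have df (x : R) : a < x < b -> derivable f x 1.
  by move=> xab; apply/f_diff/int_ab; rewrite in_itv.
have [Aq Bq] := (powR_ge0 `|f' a| q, powR_ge0 `|f' b| q).
have H1 : `|f c * (1 / c - 1 / b) -
      \int[lebesgue_measure]_(x in `[c, b]) (f x / x ^+ 2)| <=
    (b - a) ^+ 2 / 2 * (C1 a b `^ (1 - 1 / q) *
      (C2 a b * `|f' a| `^ q + C3 a b * `|f' b| `^ q) `^ (1 / q)).
  have V1 : 1 / b < 1 / c by rewrite !div1r ltf_pV2.
  have -> : 1 / c - 1 / b = `|1 / c - 1 / b| by rewrite gtr0_norm// subr_gt0.
  have := @half_interval_estimate _ a b a0 b0 ab_neq f q _ _ q1 Aq Bq; rewrite -/c.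
  rewrite (min_idPl (ltW cb)) (max_idPr (ltW cb)).
  apply; first exact: cf_sub (ltW ac) (lexx b).
    by move=> z /(sub_ab _ _ (ltW ac) (lexx b)); exact: df.
  by move=> z /(sub_ab _ _ (ltW ac) (lexx b)); exact: f'q.
(* The half-interval estimate with [a] and [b] exchanged; the weights of the two endpoints are the
   same functions of [z] as before, listed in the other order. *)
have H2 : `|f c * (1 / a - 1 / c) -
      \int[lebesgue_measure]_(x in `[a, c]) (f x / x ^+ 2)| <=
    (a - b) ^+ 2 / 2 * (C1 b a `^ (1 - 1 / q) *
      (C2 b a * `|f' b| `^ q + C3 b a * `|f' a| `^ q) `^ (1 / q)).
  have V2 : 1 / c < 1 / a by rewrite !div1r ltf_pV2.
  have -> : 1 / a - 1 / c = `|1 / c - 1 / a|.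
    by rewrite ltr0_norm ?subr_lt0// opprB.
  have := @half_interval_estimate _ b a b0 a0 ba_neq f q _ _ q1 Bq Aq.
  rewrite (_ : 2 * b * a / (b + a) = c); last first.
    by rewrite /c; congr (_ / _); ring.
  rewrite (min_idPr (ltW ac)) (max_idPl (ltW ac)).
  apply; first exact: cf_sub (lexx a) (ltW cb).
    by move=> z /(sub_ab _ _ (lexx a) (ltW cb)); exact: df.
  move=> z zac; have zab := sub_ab _ _ (lexx a) (ltW cb) _ zac.
  have z0 : z != 0 by case/andP: zab => az _; rewrite gt_eqF// (lt_trans a0).
  rewrite [leRHS]addrC.
  have -> : - b / (a - b) + b * a / (a - b) / z =
      b / (b - a) + - (a * b) / (b - a) / z.
    by field; rewrite z0 !subr_eq0 ab_neq ba_neq.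
  have -> : a / (a - b) + - (b * a) / (a - b) / z =
      - a / (b - a) + a * b / (b - a) / z.
    by field; rewrite z0 !subr_eq0 ab_neq ba_neq.
  exact: f'q.
have := @Rintegral_itvB R (fun x => f x / x ^+ 2) (BLeft a) (BRight b) c.
rewrite !bnd_simp => /(_ (integrable_div_sqr a0 cf) (ltW ac) (ltW cb)).
(* Subtracting [[a, c]] from [[a, b]] leaves an interval open at [c]; adding that point does not
   change the integral. *)
rewrite Rintegral_itv_obnd_cbnd; last first.
  apply: integrableS (integrable_div_sqr c0 (cf_sub _ _ (ltW ac) (lexx b))) => //.
  by apply: subset_itvr; rewrite bnd_simp.
rewrite (addrC (C3 b a * _)); move: H1 H2.
set J := \int[lebesgue_measure]_(x in `[a, b]) (f x / x ^+ 2).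
set J1 := \int[lebesgue_measure]_(x in `[c, b]) (f x / x ^+ 2).
set J2 := \int[lebesgue_measure]_(x in `[a, c]) (f x / x ^+ 2).
set S1 := C1 a b `^ _ * _; set S2 := C1 b a `^ _ * _.
move=> H1 H2 JE.
have ba0 : 0 < b - a by rewrite subr_gt0.
have k0 : 0 < a * b / (b - a) by rewrite divr_gt0// mulr_gt0.
(* [a * b / (b - a)] is the inverse of [1 / a - 1 / b], so [f c] splits between the two halves
   according to their weights. *)
have -> : f c - a * b / (b - a) * J = a * b / (b - a) *
    ((f c * (1 / c - 1 / b) - J1) + (f c * (1 / a - 1 / c) - J2)).
  rewrite -JE; field.
  by rewrite !gt_eqF.
have -> : a * b * (b - a) / 2 * (S1 + S2) = a * b / (b - a) *
    ((b - a) ^+ 2 / 2 * S1 + (a - b) ^+ 2 / 2 * S2).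
  by field; rewrite gt_eqF.
rewrite normrM gtr0_norm// ler_pM2l//.
exact: le_trans (ler_normD _ _) (lerD H1 H2).
Qed.
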